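(* With $\mathcal{SW},\mathcal{E}mb,\mathcal{SC},\mathcal{BC}$ denoting the families of subsets of $\mathbb{R}$ defined in the context, and $\lambda^*$ denoting Lebesgue outer measure on $\mathbb{R}$: (i) $\mathcal{SW}\not\subseteq\mathcal{BC}$ and $\mathcal{BC}\not\subseteq\mathcal{SW}$; (ii) $\mathcal{E}mb\not\subseteq\mathcal{SC}$ and $\mathcal{SC}\not\subseteq\mathcal{E}mb$; (iii) there exists a set $A\subseteq[0,1]$ with $\lambda^*(A)=1$ such that $A\notin\mathcal{E}mb$; (iv) there exists a set $A\subseteq[0,1]$, with $A\cap I$ of second category for each closed interval $I\subseteq[0,1]$, such that $A\notin\mathcal{E}mb$; (v) there exists a set $A\subseteq[0,1]$ with $\lambda^*(A)=1$ such that $A\notin\mathcal{BC}$; (vi) there exists a set $A\subseteq[0,1]$, with $A\cap I$ of second category for each closed interval $I\subseteq[0,1]$, such that $A\notin\mathcal{BC}$; (vii) there exists a (Lebesgue) non-measurable set $A$ with $A\in\mathcal{BC}$; (viii) there exists $A\in(\mathcal{SW}\cap\mathcal{E}mb)\setminus\mathcal{SC}$; (ix) $\mathcal{SC}\subsetneq\mathcal{SW}$ and $\mathcal{SC}\subsetneq\mathcal{BC}$.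
   Context: For $A\subseteq\mathbb{R}$ put $d(A):=A-A=\{a-a':a,a'\in A\}$. Two subsets of $\mathbb{R}$ are similar if one is the image of the other under an affine map $f(x)=mx+c$ with $m\neq0$. The families of subsets of $\mathbb{R}$ are: $\mathcal{SW}:=\{A: d(A)\text{ contains an interval}\}$ (a non-degenerate interval); $\mathcal{E}mb:=\{A:\text{ for each finite set }F\subseteq\mathbb{R},\ A\text{ contains a set }\widetilde F\text{ similar to }F\}$; $\mathcal{SC}:=\{A: A\text{ is shift-compact}\}$, where $A$ is shift-compact if for every sequence $z_n\to0$ in $\mathbb{R}$ there is $t\in A$ with $t+z_m\in A$ for infinitely many $m$; $\mathcal{BC}:=\{A:\text{ every additive }f:\mathbb{R}\to\mathbb{R}\text{ that is bounded above on }A\text{ is linear (i.e. continuous)}\}$. Closed intervals are non-degenerate; second category means non-meagre. *)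

(* Defs.v *)
From mathcomp Require Import all_boot all_order all_algebra.
From mathcomp Require Import all_classical all_reals all_analysis.

Set Implicit Arguments.
Unset Strict Implicit.
Unset Printing Implicit Defensive.
Import Order.TTheory GRing.Theory Num.Theory.
Import numFieldNormedType.Exports.
Local Open Scope classical_set_scope.
Local Open Scope ring_scope.

Definition difference_set (R : realType) (A : set R) : set R :=
  [set a - a' | a in A & a' in A].

Definition affine_similar (R : realType) (A B : set R) : Prop :=
  exists m c : R, m != 0 /\ B = (fun x => m * x + c) @` A.

(* Every non-degenerate interval, of whatever kind, contains a non-degenerate
   closed one, so only the latter need be considered. *)
Definition SW (R : realType) : set (set R) :=
  [set A | exists a b : R, a < b /\ `[a, b] `<=` difference_set A].

Definition Emb (R : realType) : set (set R) :=
  [set A | forall F : set R, finite_set F ->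
     exists F' : set R, affine_similar F F' /\ F' `<=` A].

Definition shift_compact (R : realType) (A : set R) : Prop :=
  forall z : R^nat, z @ \oo --> (0 : R) ->
    exists t : R, A t /\ infinite_set [set m : nat | A (t + z m)].

Definition SC (R : realType) : set (set R) := [set A | shift_compact A].

(* R^o is R as a module over itself: linearity is linearity over R, whereas
   {additive R -> R} only asks for compatibility with the group structure. *)
Definition BC (R : realType) : set (set R) :=
  [set A | forall f : {additive R -> R},
     has_ubound (f @` A) -> linear (f : R^o -> R^o)].

(* mu^* is the outer measure obtained from a set function mu on a semiring
   (here the length of the half-open intervals ]a, b]) by countable covers. *)
Definition lebesgue_outer_measure (R : realType) (A : set R) : \bar R :=
  ((wlength (@idfun R))^*)%mu A.

(* Caratheodory's criterion; by completed_caratheodory_measurable this is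
   membership in the completion of the Borel sigma-algebra. *)
Definition lebesgue_measurable (R : realType) (A : set R) : Prop :=
  caratheodory_measurable (@lebesgue_outer_measure R) A.

Definition nowhere_dense (T : topologicalType) (A : set T) : Prop :=
  interior (closure A) = set0.

Definition meagre (T : topologicalType) (A : set T) : Prop :=
  exists F : nat -> set T, (forall n, nowhere_dense (F n)) /\
    A = \bigcup_n F n.

Definition second_category (T : topologicalType) (A : set T) : Prop :=
  ~ meagre A.

Arguments SW : clear implicits.
Arguments Emb : clear implicits.
Arguments SC : clear implicits.
Arguments BC : clear implicits.

(* Main.v *)
Require Import Defs.
From HB Require Import structures.
From mathcomp Require Import all_boot all_order all_algebra.
From mathcomp Require Import all_classical all_reals all_analysis.
From mathcomp Require Import wochoice ring lra.

Set Implicit Arguments.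
Unset Strict Implicit.
Unset Printing Implicit Defensive.
Import Order.TTheory GRing.Theory Num.Theory.
Import numFieldNormedType.Exports.
Local Open Scope classical_set_scope.
Local Open Scope ring_scope.

(* Let [f] be a non-continuous additive function with rational values and
   [f 1 = 1].  The set [f <= 0] absorbs translates of finite sets, hence lies in
   SW and Emb, but not in BC.  The set where the integer part of [f] is even
   covers the line together with its translate by 1, hence lies in BC, while its
   difference set misses the dense set [f = 1].

   A set invariant under positive rational dilations is either null on the
   half-line or of full outer measure in [0, 1], and likewise for category; so
   if countably many such sets cover the half-line then one of them is full.  This
   applies to [f <= 0] and [f >= 0], and to the classes of reals whose rational
   coordinates in a Hamel basis have a given shape up to dilation: three terms
   of a progression in one class are rational multiples of one another, so a class
   contains no copy of {0, 1, 2, pi, 2 pi}.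

   A progression-free shift-compact set is built by transfinite recursion: for
   the j-th null sequence, the reals t_j + w with w = 0 or in a lacunary
   subsequence, where t_j avoids the rational span of everything chosen or
   enumerated so far.  In a relation x + z = 2 y the last t_j cannot cancel. *)

(** * Rational coordinates *)

Section rational_combinations.
Variable R : realType.
Implicit Types (s : seq (rat * R)) (B : set R) (x b : R).

(** A list stands for a formal combination in which a real may recur; [coef] gathers the
    recurrences, so independence is phrased with it. *)
Definition comb s : R := \sum_(p <- s) ratr p.1 * p.2.

Definition coef s b : rat := \sum_(p <- s | p.2 == b) p.1.

Definition scale (q : rat) s := [seq (q * p.1, p.2) | p <- s].

Lemma comb_cat s1 s2 : comb (s1 ++ s2) = comb s1 + comb s2.
Proof. by rewrite /comb big_cat. Qed.

Lemma coef_cat s1 s2 b : coef (s1 ++ s2) b = coef s1 b + coef s2 b.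
Proof. by rewrite /coef big_cat. Qed.

Lemma comb_scale q s : comb (scale q s) = ratr q * comb s.
Proof.
rewrite /comb big_map mulr_sumr; apply: eq_bigr => p _ /=.
by rewrite rmorphM mulrA.
Qed.

Lemma coef_scale q s b : coef (scale q s) b = q * coef s b.
Proof. by rewrite /coef big_map mulr_sumr. Qed.

Lemma comb_filter s x :
  comb s = ratr (coef s x) * x + comb [seq p <- s | p.2 != x].
Proof.
rewrite /comb (bigID (fun p => p.2 == x)) big_filter /=; congr (_ + _).
rewrite /coef rmorph_sum mulr_suml.
by apply: eq_bigr => p /eqP ->.
Qed.

Lemma coef_filter s x b : b != x ->
  coef [seq p <- s | p.2 != x] b = coef s b.
Proof.
move=> bx; rewrite /coef big_filter_cond; apply: eq_bigl => p.
by case: (eqVneq p.2 b) => [->|]; rewrite ?bx ?andbF.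
Qed.

Lemma coef_filter_id s x : coef [seq p <- s | p.2 != x] x = 0.
Proof.
by rewrite /coef big_filter_cond big1// => p /andP[/negPf ->].
Qed.

Lemma coef_support s b : coef s b != 0 -> b \in [seq p.2 | p <- s].
Proof.
apply: contraNT => bs; rewrite /coef big_seq_cond big1// => p /andP[ps /eqP pb].
by move/negP: bs => []; rewrite -pb map_f.
Qed.

(** Induction on the length: all pairs carrying the first real are removed at once, and together
    they contribute nothing. *)
Lemma comb_coef0 s : (forall b, coef s b = 0) -> comb s = 0.
Proof.
have [n sn] := ubnP (size s); elim: n s sn => // n IH [|p s] sn s0.
  by rewrite /comb big_nil.
rewrite (comb_filter _ p.2) s0 rmorph0 mul0r add0r; apply: IH.
  rewrite /= eqxx /=; apply: leq_ltn_trans (sn : (size s < n)%N).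
  by rewrite size_filter count_size.
move=> b; have [->|bp] := eqVneq b p.2; first exact: coef_filter_id.
by rewrite coef_filter.
Qed.

Definition over B s := forall p, p \in s -> B p.2.

Lemma over_cat B s1 s2 : over B s1 -> over B s2 -> over B (s1 ++ s2).
Proof. by move=> b1 b2 p; rewrite mem_cat => /orP[/b1|/b2]. Qed.

Lemma over_scale B q s : over B s -> over B (scale q s).
Proof. by move=> Bs p /mapP[p' /Bs ? ->]. Qed.

Definition independent B := forall s, over B s -> comb s = 0 ->
  forall b, coef s b = 0.

(** A Hamel basis, by Zorn's lemma: a finite list over the union of a chain already lies over one
    member. If [x] is outside a maximal [B], some relation over [B] and [x] has a nonzero
    coefficient at [x] and can be solved for [x]. *)
Lemma maximal_independent : exists B, independent B /\
  forall x, exists s, over B s /\ comb s = x.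
Proof.
have [|B [iB maxB]] := @Zorn_bigcup R independent.
  move=> F Find Ftot s sF s0 b.
  case: s sF s0 => [|p0 s0] sF s00; first by rewrite /coef big_nil.
  suff [X FX Xs] : exists2 X, F X & over X (p0 :: s0) by exact: Find Xs s00 b.
  elim: s0 p0 sF {s00} => [|p1 s IH] p0 sF.
    have [X FX Xp] := sF p0 (mem_head _ _); exists X => //.
    by move=> p; rewrite inE => /eqP ->.
  have [|X FX Xs] := IH p1; first by move=> p ps; apply: sF; rewrite inE ps orbT.
  have [Y FY Yp] := sF p0 (mem_head _ _).
  have [XY|YX] := Ftot _ _ FX FY.
  - by exists Y => // p; rewrite inE => /predU1P[->//|/Xs/XY].
  - by exists X => // p; rewrite inE => /predU1P[->|/Xs//]; exact: YX.
exists B; split=> // x; have [Bx|nBx] := pselect (B x).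
  exists [:: (1, x)]; split; first by move=> p; rewrite inE => /eqP ->.
  by rewrite /comb big_seq1 rmorph1 mul1r.
have : ~ independent (B `|` [set x]).
  by apply: maxB; split=> [y By|/(_ x)]; [left|move=> /(_ (or_intror erefl))].
move=> /existsNP[s] /not_implyP[Bs] /not_implyP[s0] /existsNP[b /eqP sb].
set s' := [seq p <- s | p.2 != x].
have Bs' : over B s'.
  move=> p; rewrite mem_filter => /andP[px /Bs[//|px']].
  by move: px; rewrite px' eqxx.
have ss' := comb_filter s x; rewrite -/s' s0 in ss'.
have [sx|sx] := eqVneq (coef s x) 0.
  move: ss'; rewrite sx rmorph0 mul0r add0r => /esym s'0.
  have bx : b != x by apply: contra_neq sb => ->.
  by move: sb; rewrite -(coef_filter s bx) iB ?eqxx.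
exists (scale (- (coef s x)^-1) s'); split; first exact: over_scale.
rewrite comb_scale; have -> : comb s' = - (ratr (coef s x) * x) by lra.
by rewrite rmorphN fmorphV mulrNN mulKf// fmorph_eq0.
Qed.

(** Coordinates in a Hamel basis, equal to 0 at reals off the basis. Linearity is uniqueness: a list
    evaluating to 0 has only zero coefficients. *)
Lemma rational_coordinates : exists c : R -> R -> rat,
  [/\ forall p q x y b,
        c (ratr p * x + ratr q * y) b = p * c x b + q * c y b,
      forall x, exists s : seq R, forall b, c x b != 0 -> b \in s &
      forall x, (forall b, c x b = 0) -> x = 0].
Proof.
have [B [iB spanB]] := maximal_independent.
have [S PS] := choice spanB.
exists (fun x => coef (S x)); split=> [p q x y b|x|x].
- set z := _ + _; have [Bx Ex] := PS x; have [By Ey] := PS y.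
  have [Bz Ez] := PS z.
  have /iB : over B (scale p (S x) ++ scale q (S y) ++ scale (-1) (S z)).
    by apply: over_cat; [|apply: over_cat]; apply: over_scale.
  rewrite !comb_cat !comb_scale Ex Ey Ez => /(_ _ b).
  rewrite !coef_cat !coef_scale rmorphN1 mulN1r addrA subrr => /(_ erefl).
  by rewrite mulN1r addrA => /eqP; rewrite subr_eq0 => /eqP.
- by exists [seq p.2 | p <- S x] => b /coef_support.
- by have [_ {2}<-] := PS x; exact: comb_coef0.
Qed.

End rational_combinations.

(** * Additive functions *)

Lemma pi_notrat (R : realType) (q : rat) : ratr q <> pi :> R.
Proof. by move=> qpi; apply: (@pi_irrationnal R); exists q. Qed.

Section additive_functions.
Variable R : realType.
Implicit Types (A : set R) (x y z : R) (q : rat).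

Lemma exists_nat_gt x : exists n : nat, x < n%:R.
Proof.
exists (Num.bound `|x|).
exact: le_lt_trans (ler_norm _) (archi_boundP (normr_ge0 _)).
Qed.

Lemma additive_ratrM (f : {additive R -> R}) q x :
  f (ratr q * x) = ratr q * f x.
Proof.
have d0 : (denq q)%:~R != 0 :> R by rewrite intr_eq0 denq_eq0.
have nE : (denq q)%:~R * ratr q = (numq q)%:~R :> R.
  by rewrite /ratr mulrC mulfVK.
have fz (n : int) y : f (n%:~R * y) = n%:~R * f y.
  by rewrite mulrzl raddfMz mulrzl.
by apply: (mulfI d0); rewrite -fz !(mulrA (denq q)%:~R (ratr q)) nE fz.
Qed.

Lemma additive_rat (f : {additive R -> R}) q : f (ratr q) = ratr q * f 1.
Proof. by rewrite -additive_ratrM mulr1. Qed.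

Lemma additive_nat (f : {additive R -> R}) n : f n%:R = n%:R * f 1.
Proof. by rewrite raddfMn mulr_natl. Qed.

Lemma linear_realP (f : {additive R -> R}) :
  linear (f : R^o -> R^o) <-> forall x, f x = x * f 1.
Proof.
split=> [lf x|fE a u v].
  by have := lf x 1 0; rewrite !addr0 raddf0 addr0 /GRing.scale /= mulr1.
by rewrite /GRing.scale /= raddfD /= (fE (a * u)) (fE u) mulrA.
Qed.

(** If [f x] exceeds [x * f 1], subtract from [n * x] a rational within [d] of it: at the result,
    [f] is [n * (f x - x * f 1)] up to an error [d * |f 1|], too large for large [n]. The reverse
    inequality comes from [- x]. *)
Lemma additive_locally_bounded (f : {additive R -> R}) (d K : R) : 0 < d ->
  (forall z, `|z| < d -> f z <= K) -> linear (f : R^o -> R^o).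
Proof.
move=> d0 fK; apply/linear_realP.
suff le_lin x : f x <= x * f 1.
  move=> x; apply/eqP; rewrite eq_le le_lin /=.
  by have := le_lin (- x); rewrite raddfN mulNr lerN2.
rewrite leNgt; apply/negP => ltf.
set g := f x - x * f 1; have g0 : 0 < g by rewrite subr_gt0.
set K' := K + d * `|f 1|.
have [n nK] := exists_nat_gt (K' / g).
have [q /andP[q1 q2]] : exists q, n%:R * x - d < ratr q < n%:R * x + d.
  have [|q] := @rat_in_itvoo R (n%:R * x - d) (n%:R * x + d); first by lra.
  by rewrite in_itv /=; exists q.
have zd : `|n%:R * x - ratr q| < d by rewrite ltr_norml; apply/andP; split; lra.
have := fK _ zd; rewrite raddfB /= additive_rat mulr_natl raddfMn -mulr_natl.
have zf : - (d * `|f 1|) <= (n%:R * x - ratr q) * f 1.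
  rewrite lerNl -mulNr; apply: le_trans (ler_norm _) _.
  by rewrite normrM normrN ler_pM// ltW.
move: nK; rewrite ltr_pdivrMr// /g /K' => nK fle.
have : n%:R * (f x - x * f 1) + (n%:R * x - ratr q) * f 1 <= K.
  by apply: le_trans fle; rewrite le_eqVlt; apply/orP; left; apply/eqP; ring.
lra.
Qed.

(** A coordinate that does not vanish at 1, normalised there. It has rational values and fixes the
    rationals, so [pi - f pi] lies in its kernel; irrationality of [pi] makes this nonzero and
    refutes linearity. *)
Lemma rational_functional : exists f : {additive R -> R},
  [/\ f 1 = 1, exists2 v, v != 0 & f v = 0 & ~ linear (f : R^o -> R^o)].
Proof.
have [c [clin _ cinj]] := rational_coordinates R.
have [b cb] : exists b, c 1 b != 0.
  apply: contrapT => nb; have /eqP : 1 = 0 :> R; last by rewrite oner_eq0.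
  apply: cinj => b.
  by apply/eqP; apply: contrapT => /negP cb; apply: nb; exists b.
pose f0 x : R := ratr (c x b / c 1 b).
have f0B : zmod_morphism f0.
  move=> x y; rewrite /f0.
  have := clin 1 (-1) x y b; rewrite rmorphN1 rmorph1 !mul1r !mulN1r => ->.
  by rewrite mulrBl rmorphB.
have [f fE] : exists f : {additive R -> R}, forall x, f x = f0 x.
  pose f : {additive R -> R} :=
    HB.pack f0 (GRing.isZmodMorphism.Build R R f0 f0B).
  by exists f.
have f1 : f 1 = 1 by rewrite fE /f0 divff// rmorph1.
have ffE x : f (f x) = f x by rewrite {1}[f x]fE additive_rat f1 mulr1 fE.
exists f; split=> //.
- exists (pi - f pi); last by rewrite raddfB ffE subrr.
  by apply/eqP => /subr0_eq; rewrite fE => /esym; exact: pi_notrat.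
- by move=> /linear_realP /(_ pi); rewrite f1 mulr1 fE; exact: pi_notrat.
Qed.

(** Otherwise a null sequence of non-negative reals avoids the difference set, whereas [t] and
    [t + z m] in [A] make [z m] a difference. *)
Lemma SC_sub_SW : SC R `<=` SW R.
Proof.
move=> A scA; apply: contrapT => nSW.
have zP n : exists z, 0 <= z <= n.+1%:R^-1 /\ ~ difference_set A z.
  apply: contrapT => nz; apply: nSW; exists 0, n.+1%:R^-1; split=> //.
  move=> z; rewrite /= in_itv /= => zn; apply: contrapT => nAz.
  by apply: nz; exists z.
have [z {}zP] := choice zP.
have z0 : z @ \oo --> 0.
  apply: (@squeeze_cvgr _ _ _ _ (fun=> 0) harmonic).
  - by apply: nearW => n; have [] := zP n.
  - exact: cvg_cst.
  - exact: cvg_harmonic.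
have [t [At /infinite_setN0[m /= Am]]] := scA z z0.
by have [_] := zP m; apply; exists (t + z m) => //; exists t => //; lra.
Qed.

(** A non-linear [f] is unbounded above near 0, so some null sequence has [f (z n) > n]; then
    [f (t + z m)] stays below a given bound for finitely many [m] only. *)
Lemma SC_sub_BC : SC R `<=` BC R.
Proof.
move=> A scA f [K fK]; apply: contrapT => nlin.
have zP n : exists z, `|z| < n.+1%:R^-1 /\ n%:R < f z.
  apply: contrapT => nz; apply: nlin.
  apply: (@additive_locally_bounded f n.+1%:R^-1 n%:R) => // z zn.
  by rewrite leNgt; apply/negP => fz; apply: nz; exists z.
have [z {}zP] := choice zP.
have z0 : z @ \oo --> 0.
  apply/norm_cvg0P; apply: (@squeeze_cvgr _ _ _ _ (fun=> 0) harmonic).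
  - by apply: nearW => n; rewrite normr_ge0 ltW//; have [] := zP n.
  - exact: cvg_cst.
  - exact: cvg_harmonic.
have [t [At infA]] := scA z z0.
have [N NK] := exists_nat_gt (K - f t).
have : ~ finite_set [set m | A (t + z m)] by [].
apply; apply: (sub_finite_set _ (finite_II N)) => m /= Am.
rewrite ltnNge; apply/negP => Nm.
have := fK _ (imageP f Am); rewrite raddfD /=.
have [_] := zP m; have : N%:R <= m%:R :> R by rewrite ler_nat.
lra.
Qed.

Lemma BC_superset A B : A `<=` B -> BC R A -> BC R B.
Proof.
move=> AB bcA f [K fK]; apply: bcA; exists K => _ [x Ax <-].
by apply: fK; exists x => //; exact: AB.
Qed.

Lemma BC_interval (a b : R) : a < b -> BC R `[a, b]%classic.
Proof.
move=> ab f [K fK].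
apply: (@additive_locally_bounded f ((b - a) / 2) (K - f ((a + b) / 2))).
  by lra.
move=> z; rewrite ltr_norml => /andP[z1 z2].
have : f (z + (a + b) / 2) <= K.
  by apply: fK; exists (z + (a + b) / 2) => //; rewrite /= in_itv /=; lra.
by rewrite raddfD /=; lra.
Qed.

Definition nonpos_set (f : R -> R) : set R := [set x | f x <= 0].

Lemma nonpos_notBC (f : {additive R -> R}) A :
  ~ linear (f : R^o -> R^o) -> A `<=` nonpos_set f -> ~ BC R A.
Proof.
by move=> nlin Af; apply: contra_not nlin; apply; exists 0 => _ [x /Af ? <-].
Qed.

Lemma finite_set_bounded (f : R -> R) (F : set R) : finite_set F ->
  exists n : nat, forall x, F x -> f x <= n%:R.
Proof.
move=> /finite_seqP[s ->{F}]; elim: s => [|x s [n IH]]; first by exists 0%N.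
have [m fm] := exists_nat_gt (f x).
exists (maxn n m) => y; rewrite /= inE => /predU1P[->|ys].
  by rewrite (le_trans (ltW fm))// ler_nat leq_maxr.
by rewrite (le_trans (IH _ ys))// ler_nat leq_maxl.
Qed.

Lemma nonpos_Emb (f : {additive R -> R}) : f 1 = 1 -> Emb R (nonpos_set f).
Proof.
move=> f1 F /(finite_set_bounded f)[n Fn].
exists ((fun x => 1 * x + (- n%:R)) @` F); split.
  by exists 1, (- n%:R); rewrite oner_neq0.
move=> _ [x /Fn fx <-]; rewrite /nonpos_set /= mul1r raddfB /= additive_nat f1.
lra.
Qed.

(** Write [x] as [(x - n) - (- n)] with [n] large. *)
Lemma nonpos_SW (f : {additive R -> R}) : f 1 = 1 -> SW R (nonpos_set f).
Proof.
move=> f1; exists 0, 1; split=> // x _.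
have [|n fn] := @finite_set_bounded f [set x; 0]; first exact: finite_set2.
have := fn x (or_introl erefl); have := fn 0 (or_intror erefl).
rewrite raddf0 => n0 xn; exists (x - n%:R); last exists (- n%:R); last by lra.
- by rewrite /nonpos_set /= raddfB /= additive_nat f1; lra.
- by rewrite /nonpos_set /= raddfN /= additive_nat f1; lra.
Qed.

Definition even_part (f : R -> R) : set R :=
  [set x | exists k : int, 2 * k%:~R <= f x < 2 * k%:~R + 1].

(** One of [z] and [z - 1] lies in the set, so [h] is at most [K + |h 1|] on the whole line; the
    radius 1 is arbitrary. *)
Lemma even_part_BC (f : {additive R -> R}) : f 1 = 1 -> BC R (even_part f).
Proof.
move=> f1 h [K hK].
apply: (@additive_locally_bounded h 1 (K + `|h 1|)) => // z _.
set m := Num.floor (f z).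
have m1 : m%:~R <= f z := floor_le (f z).
have m2 : f z < m%:~R + 1 by have := floorD1_gt (f z); rewrite intrD.
have h1 := ler_norm (h 1); have h1' := normr_ge0 (h 1).
have [m0|m0] := eqVneq (m %% 2)%Z 0.
  have : h z <= K.
    apply: hK; exists z => //; exists (m %/ 2)%Z.
    move: m1 m2; rewrite {1 2}[m](divz_eq m 2) m0 addr0 intrM; lra.
  by lra.
have m01 : (m %% 2)%Z = 1.
  have := @modz_ge0 m 2 isT; have := @ltz_pmod m 2 isT.
  by move: m0; case: (m %% 2)%Z => [[|[|]]|].
have : h (z - 1) <= K.
  apply: hK; exists (z - 1) => //; exists (m %/ 2)%Z.
  move: m1 m2; rewrite {1 2}[m](divz_eq m 2) m01 intrD intrM raddfB /= f1; lra.
by rewrite raddfB /=; lra.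
Qed.

(** The points [1 + q * v] with [q] rational are dense and have [f]-value 1. A difference of two
    members with that value would put the integer [k - l] strictly between 0 and 1. *)
Lemma even_part_notSW (f : {additive R -> R}) v : f 1 = 1 -> v != 0 -> f v = 0 ->
  ~ SW R (even_part f).
Proof.
move=> f1 v0 fv [a [b [ab abA]]].
have [q /andP[qa qb]] : exists q, a < 1 + ratr q * v < b.
  have [vn|vp|/eqP] := ltgtP v 0; last by rewrite (negbTE v0).
  - have [|q] := @rat_in_itvoo R ((b - 1) / v) ((a - 1) / v).
      by rewrite ltr_nM2r ?invr_lt0//; lra.
    rewrite in_itv /= ltr_ndivrMr// ltr_ndivlMr// => q12; exists q; lra.
  - have [|q] := @rat_in_itvoo R ((a - 1) / v) ((b - 1) / v).
      by rewrite ltr_pM2r ?invr_gt0//; lra.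
    rewrite in_itv /= ltr_pdivrMr// ltr_pdivlMr// => q12; exists q; lra.
have [|x [k xk] [y [l yl] xyq]] := abA (1 + ratr q * v).
  by rewrite /= in_itv /=; lra.
have : f (x - y) = 1 by rewrite xyq raddfD /= additive_ratrM fv mulr0 f1 addr0.
rewrite raddfB /= => fxy.
have kl : l%:~R < k%:~R :> R by lra.
have lk : k%:~R < l%:~R + 1 :> R by lra.
by move: kl lk; rewrite -[1]/1%:~R -intrD !ltr_int ltzD1 ltNge => /negP.
Qed.

End additive_functions.

(** * Outer measure and dilations *)

Definition rat_invariant (R : realType) (S : set R) :=
  forall q x, 0 < q -> S x -> S (ratr q * x).

Section outer_measure.
Variable R : realType.
Implicit Types (A B S : set R) (a b x y m c : R).
Local Notation mu := (@lebesgue_outer_measure R).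

Lemma outer_le A B : A `<=` B -> (mu A <= mu B)%E.
Proof. by move=> AB; rewrite /lebesgue_outer_measure le_outer_measure. Qed.

Lemma outer_ge0 A : (0 <= mu A)%E.
Proof. exact: outer_measure_ge0. Qed.

Lemma outer_set0 : mu set0 = 0%E.
Proof. exact: outer_measure0. Qed.

Lemma outer_bigcup0 (F : nat -> set R) : (forall n, mu (F n) = 0%E) ->
  mu (\bigcup_n F n) = 0%E.
Proof.
move=> F0; apply/eqP; rewrite eq_le outer_ge0 andbT.
apply: le_trans (outer_measure_sigma_subadditive _ _) _.
by rewrite eseries0// => i _ _; exact: F0.
Qed.

Lemma outer_itv a b : a <= b -> mu `]a, b]%classic = (b - a)%:E.
Proof.
move=> ab; rewrite /lebesgue_outer_measure measurable_mu_extE/=.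
  by rewrite wlength_itv_bnd.
exact: is_ocitv.
Qed.

Lemma outer_itv_split X a b :
  mu X = (mu (X `&` `]a, b]) + mu (X `&` ~` `]a, b]))%E.
Proof.
have := @caratheodory_measurable_mu_ext _ R _ (wlength (@idfun R)).
by apply; exact: is_ocitv.
Qed.

Lemma image_affine_itv m c a b : 0 < m ->
  (fun x => m * x + c) @` `]a, b]%classic = `]m * a + c, m * b + c]%classic.
Proof.
move=> m0; apply/seteqP; split=> [_ [x + <-]|x].
  by rewrite /= !in_itv /= ltrD2r lerD2r ltr_pM2l// ler_pM2l.
rewrite /= in_itv /= => /andP[x1 x2]; exists ((x - c) / m).
  rewrite in_itv /= ltr_pdivlMr// ler_pdivrMr//; lra.
by rewrite mulrC divfK ?gt_eqF// subrK.
Qed.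

(** Covers are transported interval by interval; [m > 0] keeps the half-open intervals closed on the
    right. The inverse map yields the opposite inequality. *)
Lemma outer_affine m c A : 0 < m ->
  (mu ((fun x => m * x + c)%R @` A) <= m%:E * mu A)%E.
Proof.
move=> m0; rewrite -lee_pdivrMl//; apply: le_ereal_inf_tmp => _ [F [mF AF] <-].
rewrite lee_pdivrMl// -nneseriesZl; last by move=> i _; exact: measure_ge0.
pose F' k : set (ocitv_type R) := (fun x => m * x + c) @` F k.
apply: ge_ereal_inf; exists (\sum_(k <oo) wlength idfun (F' k))%E.
  exists F' => //; split=> [k|_ [x Ax <-]].
    have [[a b] /= _ Fk] := mF k; rewrite /F' -Fk image_affine_itv//.
    exact: is_ocitv.
  by have [k _ Fx] := AF x Ax; exists k => //; exists x.
rewrite le_eqVlt; apply/orP; left; apply/eqP/eq_eseriesr => k _; rewrite /F'.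
have /ocitvP[->|[[a b] /= ab ->]] := mF k.
  by rewrite image_set0 wlength0 mule0.
rewrite image_affine_itv// !wlength_itv_bnd ?ltW// ?ltrD2r ?ltr_pM2l//.
by rewrite -EFinM; congr EFin; rewrite /=; ring.
Qed.

(** * Zero-one law for sets invariant under rational dilations *)

Section zero_one_law.
Variables (S : set R) (invS : rat_invariant S).

Let G x := mu (S `&` `]0, x]).

Let G_scale (q : rat) x : 0 < q -> (G (ratr q * x) <= (ratr q)%:E * G x)%E.
Proof.
move=> q0; have q0' : 0 < ratr q :> R by rewrite ltr0q.
apply: le_trans (outer_affine 0 _ q0'); apply: outer_le => y [Sy].
rewrite /= in_itv /= => /andP[y0 yx]; exists (ratr q^-1 * y).
  split; first by apply: invS => //; rewrite invr_gt0.
  rewrite /= in_itv /= fmorphV mulr_gt0 ?invr_gt0//=.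
  by rewrite mulrC ler_pdivrMr// mulrC.
by rewrite fmorphV addr0 mulVKf// gt_eqF.
Qed.

Let c := fine (G 1).

Let G_fin x : 0 <= x -> G x \is a fin_num.
Proof.
move=> x0; rewrite ge0_fin_numE ?outer_ge0//.
apply: (@le_lt_trans _ _ x%:E); last by rewrite ltry.
by rewrite -{2}[x]subr0 -outer_itv//; apply: outer_le => y [].
Qed.

Let cE : G 1 = c%:E.
Proof. by rewrite /c fineK// G_fin. Qed.

Let c01 : 0 <= c <= 1.
Proof.
rewrite -2!lee_fin -cE outer_ge0 /=.
by rewrite -[X in X%:E]subr0 -outer_itv//; apply: outer_le => y [].
Qed.

(** [G_scale] is used for [q] and for its inverse. *)
Let G_rat (q : rat) : 0 < q -> G (ratr q) = (c * ratr q)%:E.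
Proof.
move=> q0; have q0' : 0 < ratr q :> R by rewrite ltr0q.
apply/eqP; rewrite eq_le; apply/andP; split.
  by have := G_scale 1 q0; rewrite mulr1 cE -EFinM mulrC.
have := @G_scale q^-1 (ratr q); rewrite invr_gt0 => /(_ q0).
rewrite fmorphV mulVf ?gt_eqF// cE -(fineK (G_fin (ltW q0'))) -EFinM !lee_fin.
by rewrite mulrC ler_pdivlMr.
Qed.

Let G_real x : 0 <= x -> G x = (c * x)%:E.
Proof.
rewrite le_eqVlt => /predU1P[<-|x0].
  by rewrite /G set_itv_ge ?setI0 ?outer_set0 ?mulr0// bnd_simp ltxx.
have [c0 c1] := andP c01.
have Gle y z : y <= z -> (G y <= G z)%E.
  move=> yz; apply: outer_le => t [St]; rewrite /= !in_itv /= => /andP[-> ty].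
  by split=> //; exact: le_trans yz.
rewrite -(fineK (G_fin (ltW x0))); congr EFin; apply/eqP; rewrite eq_le.
apply/andP; split; apply/ler_addgt0Pr => e e0.
(* [G] is monotone, so [G x] is squeezed between its values at rationals within [e] of [x]; [c <= 1]
   keeps the error below [e]. *)
- have [|q] := @rat_in_itvoo R x (x + e); first by lra.
  rewrite in_itv /= => /andP[xq qe].
  have q0 : 0 < q by rewrite -(@ltr0q R) (lt_trans x0).
  have := Gle _ _ (ltW xq).
  rewrite G_rat// -{1}(fineK (G_fin (ltW x0))) lee_fin.
  by move=> /le_trans; apply; nra.
- have [|q] := @rat_in_itvoo R (Num.max 0 (x - e)) x.
    by rewrite gt_max x0; lra.
  rewrite in_itv /= gt_max => /andP[/andP[q0 qe] xq].
  have q0' : 0 < q by rewrite -(@ltr0q R).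
  have := Gle _ _ (ltW xq).
  rewrite G_rat// -{1}(fineK (G_fin (ltW x0))) lee_fin.
  by move=> cq; nra.
Qed.

(** Intervals satisfy the Caratheodory criterion, so [G b] is the sum of [G a] and the measure
    sought. *)
Let G_itv a b : 0 <= a -> a <= b -> mu (S `&` `]a, b]) = (c * (b - a))%:E.
Proof.
move=> a0 ab; have b0 := le_trans a0 ab.
have := outer_itv_split (S `&` `]0, b]) a b; rewrite -/(G b) G_real//.
have -> : S `&` `]0, b] `&` `]a, b] = S `&` `]a, b].
  apply/seteqP; split=> t /=; rewrite !in_itv /=.
    by case=> -[].
  by move=> [St /andP[ta tb]]; rewrite ta tb (le_lt_trans a0 ta).
have -> : S `&` `]0, b] `&` ~` `]a, b] = S `&` `]0, a].
  apply/seteqP; split=> t /=; rewrite !in_itv /=.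
    move=> [[St /andP[t0 tb]] /negP]; rewrite tb andbT -leNgt => ta.
    by rewrite t0 ta.
  move=> [St /andP[t0 ta]]; rewrite t0 (le_trans ta)//; split=> //.
  by apply/negP; rewrite andbT -leNgt.
rewrite -/(G a) G_real// => /esym E.
by rewrite mulrBr EFinB -E addeK.
Qed.

(* Put [c = mu (S `&` `]0, 1])].  Then [mu (S `&` `]a, b]) = c * (b - a)], so any
   cover of [S `&` `]0, 1]] by intervals of total length [l] gives [c <= c * l];
   hence [c > 0] forces [c >= 1]. *)
Lemma zero_one_law :
  mu (S `&` `]0, +oo[) = 0%E \/ mu (S `&` `]0, 1]) = 1%E.
Proof.
have [c0 c1] := andP c01.
move: c0; rewrite le_eqVlt => /predU1P[c0|c0].
  left; apply/eqP; rewrite eq_le outer_ge0 andbT.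
  rewrite -(@outer_bigcup0 (fun n => S `&` `]0, n%:R])).
    apply: outer_le => x [Sx]; rewrite /= in_itv /= andbT => x0.
    have [n xn] := exists_nat_gt x.
    by exists n => //; split=> //; rewrite /= in_itv /= x0 ltW.
  by move=> n; rewrite -/(G _) G_real// -c0 mul0r.
right; rewrite -/(G 1) cE; congr EFin; apply/eqP; rewrite eq_le c1 /=.
rewrite -lee_fin -cE; apply: le_ereal_inf_tmp => _ [F [mF SF] <-].
rewrite -(lee_pmul2l _ (_ : 0 < c%:E)%E) ?lte_fin// mule1.
rewrite -nneseriesZl; last by move=> i _; exact: measure_ge0.
rewrite -{1}cE.
apply: (@le_trans _ _ (\sum_(k <oo) mu (S `&` `]0%R, 1%R] `&` F k))%E).
  apply: le_trans (outer_measure_sigma_subadditive _ _).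
  by apply: outer_le => x Sx; have [k _ Fx] := SF x Sx; exists k.
apply: lee_nneseries => [k _ _|k _]; first exact: outer_ge0.
have /ocitvP[->|[[a b] /= ab ->]] := mF k.
  by rewrite setI0 outer_set0 wlength0 mule0.
rewrite (wlength_itv_bnd _ _ _ (ltW ab)) -EFinM.
(* [G_itv] needs a non-negative left end, so the covering interval is cut at 0; in the other case
   [b] is negative and the interval misses [S] on []0, 1]]. *)
have [ab'|ab'] := leP (Num.max 0 a) b.
  apply: (@le_trans _ _ (mu (S `&` `]Num.max 0 a, b]))).
    apply: outer_le => x /= [[Sx]]; rewrite !in_itv /= gt_max.
    by move=> /andP[-> _] /andP[-> ->].
  rewrite G_itv// ?le_max ?lexx// lee_fin ler_pM2l// lerD2l lerN2.
  by rewrite le_max lexx orbT.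
suff -> : S `&` `]0, 1] `&` `]a, b] = set0.
  by rewrite outer_set0 lee_fin mulr_ge0 ?(ltW c0)//= subr_ge0 ltW.
rewrite -subset0 => x /= [[Sx]]; rewrite !in_itv /= => /andP[x0 _] /andP[xa xb].
by move: ab'; rewrite lt_max !ltNge (ltW ab) (le_trans (ltW x0) xb).
Qed.

End zero_one_law.

(** Otherwise the zero-one law makes every [A n] null on the half-line, and their union would be
    null. *)
Lemma full_outer_measure (A : nat -> set R) : (forall n, rat_invariant (A n)) ->
  `]0, +oo[%classic `<=` \bigcup_n A n ->
  exists n, mu (A n `&` `]0, 1]) = 1%E.
Proof.
move=> invA covA; apply: contrapT => nA.
have A0 n : mu (A n `&` `]0, +oo[) = 0%E.
  by have [//|An] := zero_one_law (invA n); case: nA; exists n.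
have : (mu `]0%R, 1%R]%classic <= mu (\bigcup_n (A n `&` `]0%R, +oo[)))%E.
  apply: outer_le => x; rewrite /= in_itv /= => /andP[x0 _].
  have [|n _ An] := covA x; first by rewrite /= in_itv /= x0.
  by exists n => //; split=> //; rewrite /= in_itv /= x0.
by rewrite outer_bigcup0// outer_itv// subr0 lee_fin ler10.
Qed.

End outer_measure.

(** * Category and dilations *)

Section meagre_sets.
Variable T : topologicalType.
Implicit Types (A B : set T).

Lemma nowhere_dense_subset A B : A `<=` B -> nowhere_dense B -> nowhere_dense A.
Proof.
move=> AB B0; rewrite /nowhere_dense -subset0 -B0.
exact/interiorS/closureS.
Qed.

Lemma nowhere_dense0 : nowhere_dense (@set0 T).
Proof. by rewrite /nowhere_dense closure0 interior0. Qed.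

Lemma nowhere_dense_preimage (g h : T -> T) A : continuous g -> continuous h ->
  cancel g h -> cancel h g -> nowhere_dense A -> nowhere_dense (g @^-1` A).
Proof.
move=> cg ch gK hK A0; rewrite /nowhere_dense -subset0 => x xA.
suff : interior (closure A) (g x) by rewrite A0.
have : nbhs (g x) (h @^-1` interior (closure (g @^-1` A))).
  apply: open_nbhs_nbhs; split; last by rewrite /= gK.
  by apply: open_comp; [move=> y _; exact: ch|exact: open_interior].
apply: filterS => y /= /interior_subset hy; rewrite -[y]hK.
have /closure_id E : closed (g @^-1` closure A).
  by apply: closed_comp; [move=> z _; exact: cg|exact: closed_closure].
suff : (g @^-1` closure A) (h y) by [].
by rewrite E; apply: closureS hy => z /= ?; exact: subset_closure.
Qed.

Lemma meagre_subset A B : A `<=` B -> meagre B -> meagre A.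
Proof.
move=> AB [F [F0 BF]]; exists (fun n => F n `&` A); split=> [n|].
  exact: nowhere_dense_subset (@subIsetl _ _ _) (F0 n).
by rewrite -setI_bigcupl -BF setIC; apply/esym/setIidPl.
Qed.

Lemma meagre_bigcup (I : countType) (F : I -> set T) :
  (forall i, meagre (F i)) -> meagre (\bigcup_i F i).
Proof.
move=> /choice[G FG].
exists (fun n => if unpickle n is Some p then G p.1 p.2 else set0); split.
  move=> n; case: unpickle => [p|]; last exact: nowhere_dense0.
  exact: (FG p.1).1.
apply/seteqP; split=> [x [i _]|x [n _]].
  rewrite (FG i).2 => -[n _ Gx]; exists (pickle (i, n)) => //.
  by rewrite pickleK.
case: unpickle => // -[i m] /= Gx; exists i => //.
by rewrite (FG i).2; exists m.
Qed.

Lemma meagre_preimage (g h : T -> T) A : continuous g -> continuous h ->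
  cancel g h -> cancel h g -> meagre A -> meagre (g @^-1` A).
Proof.
move=> cg ch gK hK [F [F0 ->]]; exists (fun n => g @^-1` F n); split=> [n|].
  exact: nowhere_dense_preimage hK (F0 n).
by rewrite preimage_bigcup.
Qed.

End meagre_sets.

Section second_category_real.
Variable R : realType.

(** The complements of the closures are dense and open, so Baire's theorem gives a positive real in
    all of them. *)
Lemma pos_half_line_not_meagre : ~ meagre (`]0, +oo[%classic : set R).
Proof.
move=> [F [F0 posF]].
have odF n : open (~` closure (F n)) /\ dense (~` closure (F n)).
  split; first exact/closed_openC/closed_closure.
  move=> O [x Ox] openO; apply: contrapT => nO.
  suff : interior (closure (F n)) x by rewrite F0.
  have : nbhs x O by exact: open_nbhs_nbhs.
  by apply: filterS => y Oy; apply: contrapT => nFy; apply: nO; exists y.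
have [||x [/= x0 Fx]] := @Baire R R _ odF `]0, +oo[%classic.
- by exists 1; rewrite /= in_itv /= ltr01.
- exact: interval_open.
have [n _ Fnx] : (\bigcup_n F n) x by rewrite -posF.
by have := Fx n I; apply; exact: subset_closure.
Qed.

(** Otherwise each [A n] is meagre in some [[a, b]]. Every positive [x] has a rational multiple
    [q * x] in []a, b[], so countably many dilates of the meagre piece cover the positive part of
    [A n], and the half-line would be meagre. *)
Lemma everywhere_second_category (A : nat -> set R) :
  (forall n, rat_invariant (A n)) -> `]0, +oo[%classic `<=` \bigcup_n A n ->
  exists n, forall a b : R, a < b -> `[a, b] `<=` `[(0 : R), 1] ->
    second_category (A n `&` `]0, 1] `&` `[a, b]).
Proof.
move=> invA covA; apply: contrapT => nA; apply: pos_half_line_not_meagre.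
have mA n : meagre (A n `&` `]0, +oo[).
  have : exists a b : R, [/\ a < b, `[a, b] `<=` `[(0 : R), 1] &
      meagre (A n `&` `]0, 1] `&` `[a, b])].
    apply: contrapT => nab; apply: nA; exists n => a b ab ab01 mab.
    by apply: nab; exists a, b.
  move=> [a [b [ab ab01 mab]]].
  have /andP[a0 _] : 0 <= a <= 1.
    by have := ab01 a; rewrite /= !in_itv /= lexx ltW// => /(_ isT).
  have /andP[_ b1] : 0 <= b <= 1.
    by have := ab01 b; rewrite /= !in_itv /= lexx ltW// => /(_ isT).
  pose B (q : rat) : set R := if 0 < q then
    *%R (ratr q) @^-1` (A n `&` `]0, 1] `&` `[a, b]) else set0.
  apply: (@meagre_subset _ _ (\bigcup_q B q)).
    move=> x [Ax]; rewrite /= in_itv /= andbT => x0.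
    have [|q] := @rat_in_itvoo R (a / x) (b / x).
      by rewrite ltr_pM2r ?invr_gt0.
    rewrite in_itv /= ltr_pdivrMr// ltr_pdivlMr// => /andP[qa qb].
    have q0 : 0 < q.
      by rewrite -(@ltr0q R) -(pmulr_lgt0 _ x0) (le_lt_trans a0).
    exists q => //; rewrite /B q0; split; last by rewrite /= in_itv /= !ltW.
    split; first exact: invA.
    by rewrite /= in_itv /= (le_lt_trans a0)//= (le_trans (ltW qb)).
  apply: meagre_bigcup => q; rewrite /B; case: ifPn => [q0|_].
    have q0' : (ratr q : R) != 0 by rewrite gt_eqF// ltr0q.
    apply: (@meagre_preimage R ( *%R (ratr q)) ( *%R (ratr q)^-1)) => //.
    - exact: mulrl_continuous.
    - exact: mulrl_continuous.
    - by move=> x; rewrite mulKf.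
    - by move=> x; rewrite mulVKf.
  by exists (fun=> set0); split=> [k|]; [exact: nowhere_dense0|rewrite bigcup0].
apply: meagre_subset (meagre_bigcup mA) => x x0.
by have [n _ Ax] := covA x x0; exists n.
Qed.

End second_category_real.

(** * Sets without similar copies *)

Section coordinate_types.
Variables (R : realType) (c : R -> R -> rat).
Hypothesis clin : forall p q x y b,
  c (ratr p * x + ratr q * y) b = p * c x b + q * c y b.
Hypothesis cfin : forall x, exists s : seq R, forall b, c x b != 0 -> b \in s.
Hypothesis cinj : forall x, (forall b, c x b = 0) -> x = 0.
Implicit Types (N : nat) (l : seq (int * rat)) (x y z b : R).

(* The type of [x] records a grid of mesh [1/N] separating the basis elements
   occurring in [x], and the coefficient of [x] in each cell, up to a positive
   rational factor; there are countably many types. *)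
Definition slot N b : int := Num.floor (N%:R * b).

Definition slot_coef l (k : int) : rat := \sum_(p <- l | p.1 == k) p.2.

Definition type_class N l : set R := [set x | exists2 lam : rat, 0 < lam &
  [/\ x != 0,
      forall b, c x b != 0 -> c x b = lam * slot_coef l (slot N b),
      forall k, slot_coef l k != 0 -> exists2 b, c x b != 0 & slot N b = k &
      forall b b', c x b != 0 -> c x b' != 0 -> slot N b = slot N b' -> b = b']].

Let cZ q x b : c (ratr q * x) b = q * c x b.
Proof. by have := clin q 0 x 0 b; rewrite rmorph0 !mul0r !addr0. Qed.

Lemma type_class_invariant N l : rat_invariant (type_class N l).
Proof.
move=> q x q0 [lam lam0 [x0 xl lx xinj]]; have q0' := lt0r_neq0 q0.
exists (q * lam); first exact: mulr_gt0.
split=> [|b|k /lx[b xb bk]|b b'].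
- by rewrite mulf_neq0// fmorph_eq0.
- by rewrite cZ mulf_eq0 negb_or => /andP[_ /xl ->]; rewrite mulrA.
- by exists b => //; rewrite cZ mulf_neq0.
- by rewrite !cZ !mulf_eq0 !negb_or => /andP[_ xb] /andP[_ xb']; exact: xinj.
Qed.

(** [N] bounds the inverses of all distances in [s], while two reals in the same cell are less than
    [1/N] apart. *)
Lemma slot_separates (s : seq R) :
  exists N, {in s &, forall b b', slot N b = slot N b' -> b = b'}.
Proof.
pose D := [set x | x \in [seq `|b - b'|^-1 | b <- s, b' <- s]].
have [|N ND] := @finite_set_bounded R id D; first exact: finite_seq.
exists N => b b' bs b's sbb'; apply: contrapT => /eqP bb'.
have d0 : 0 < `|b - b'| by rewrite normr_gt0 subr_eq0.
have : `|b - b'|^-1 <= N%:R.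
  by apply: ND; apply/allpairsP; exists (b, b').
rewrite -[X in X <= _]mul1r ler_pdivrMr// leNgt => /negP; apply.
rewrite -[X in X * _]ger0_norm// -normrM mulrBr ltr_norml.
have := floor_le (N%:R * b); have := floorD1_gt (N%:R * b).
have := floor_le (N%:R * b'); have := floorD1_gt (N%:R * b').
by move: sbb'; rewrite /slot !intrD => <-; lra.
Qed.

Lemma type_class_cover x : x != 0 -> exists N l, type_class N l x.
Proof.
move=> x0; have [s xs] := cfin x.
pose s' := undup [seq b <- s | c x b != 0].
have s'E b : (b \in s') = (c x b != 0).
  by rewrite mem_undup mem_filter andb_idr// => /xs.
have [N sepN] := slot_separates s'.
exists N, [seq (slot N b, c x b) | b <- s']; exists 1 => //.
split=> // [b|k|b b'].
- rewrite -s'E => bs; rewrite mul1r /slot_coef big_map /=.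
  transitivity (\sum_(b' <- s' | b' == b) c x b').
    by rewrite -big_filter filter_pred1_uniq ?undup_uniq// big_seq1.
  rewrite big_seq_cond [RHS]big_seq_cond; apply: eq_bigl => b'.
  by case: (boolP (b' \in s')) => //= b's; apply/eqP/eqP => [->|/sepN ->].
- move=> sk; apply: contrapT => nb; move/eqP: sk; apply.
  rewrite /slot_coef big_map big_seq_cond big1// => b /andP[bs /eqP bk].
  by case: nb; exists b; rewrite -?s'E.
- by rewrite -!s'E => bs b's; exact: sepN.
Qed.

(** In a common cell [x] and [z] have coefficients of the same sign, so nothing in the support of
    [x] cancels in [x + z] and that support lies in the one of [y]. Each support meets every cell
    with nonzero coefficient exactly once, so the two agree and the coordinates are proportional. *)
Lemma type_class_mid N l x y z : type_class N l x -> type_class N l y ->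
  type_class N l z -> x + z = 2 * y -> exists q, y = ratr q * x.
Proof.
move=> [lx lx0 [x0 xl xk xi]] [ly ly0 [y0 yl yk yi]] [lz lz0 [z0 zl zk zi]] xzy.
have cxz b : c x b + c z b = 2 * c y b.
  rewrite -[RHS]cZ ratr_nat -xzy.
  by have := clin 1 1 x z b; rewrite rmorph1 !mul1r => ->.
have xy b : c x b != 0 -> c y b != 0.
  move=> xb; have : c x b + c z b != 0.
    have [->|zb] := eqVneq (c z b) 0; first by rewrite addr0.
    have gb : slot_coef l (slot N b) != 0.
      by apply: contra_neq (xb) => g0; rewrite xl ?g0 ?mulr0.
    rewrite (xl _ xb) (zl _ zb) -mulrDl; apply: mulf_neq0 gb.
    by rewrite lt0r_neq0// addr_gt0.
  by rewrite cxz; apply: contra_neq => ->; rewrite mulr0.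
have yx b : c y b != 0 -> c x b != 0.
  move=> yb; have /xk[b' xb' sbb'] : slot_coef l (slot N b) != 0.
    by apply: contra_neq (yb) => g0; rewrite yl ?g0 ?mulr0.
  by rewrite -(yi _ _ (xy _ xb') yb sbb').
have cxy b : c y b = ly / lx * c x b.
  have [xb|xb] := eqVneq (c x b) 0.
    by rewrite xb mulr0; apply: contraTeq isT => /yx; rewrite xb eqxx.
  by rewrite xl// yl ?xy// mulrA divfK ?lt0r_neq0.
exists (ly / lx); apply/eqP; rewrite -subr_eq0; apply/eqP/cinj => b.
have := clin 1 (- (ly / lx)) y x b.
by rewrite rmorph1 rmorphN !mul1r mulNr => ->; rewrite cxy mulNr subrr.
Qed.

(** With [d] the image of 0, the progression 0, 1, 2 gives [m + d = q1 * d] and 0, [pi], [2 * pi]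
    gives [m * pi + d = q2 * d]; hence [pi] would be [(q2 - 1) / (q1 - 1)]. *)
Lemma type_class_notEmb N l A : A `<=` type_class N l -> ~ Emb R A.
Proof.
move=> Al /(_ [set x | x \in [:: 0; 1; 2; pi; 2 * pi]]).
move=> [|F' [[m [d [m0 ->]]] F'A]].
  exact: finite_seq.
have mem x : x \in [:: 0; 1; 2; pi; 2 * pi] -> type_class N l (m * x + d).
  by move=> xs; apply/Al/F'A; exists x.
have := mem 0; rewrite mulr0 add0r mem_head => /(_ isT) d_in.
have d0 : d != 0 by case: d_in => ? _ [].
have [||||q1 E1] := @type_class_mid N l d (m * 1 + d) (m * 2 + d).
- by [].
- by apply: mem; rewrite !inE eqxx orbT.
- by apply: mem; rewrite !inE eqxx !orbT.
- by ring.
have [||||q2 E2] := @type_class_mid N l d (m * pi + d) (m * (2 * pi) + d).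
- by [].
- by apply: mem; rewrite !inE eqxx !orbT.
- by apply: mem; rewrite !inE eqxx !orbT.
- by ring.
have md : m = (ratr q1 - 1) * d by rewrite mulrBl -E1; ring.
have q10 : ratr q1 - 1 != 0 :> R.
  by apply: contra_neq m0 => q10; rewrite md q10 mul0r.
apply: (@pi_notrat R ((q2 - 1) / (q1 - 1))).
rewrite fmorph_div !rmorphB !rmorph1; apply: (mulIf (mulf_neq0 q10 d0)).
rewrite mulrA divfK// -md mulrBl -E2; ring.
Qed.

End coordinate_types.

Lemma similar_free_cover (R : realType) : exists A : nat -> set R,
  [/\ forall n, rat_invariant (A n), `]0, +oo[%classic `<=` \bigcup_n A n &
      forall n B, B `<=` A n -> ~ Emb R B].
Proof.
have [c [clin cfin cinj]] := rational_coordinates R.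
exists (fun n => if unpickle n is Some p then type_class c p.1 p.2 else set0).
split=> [n|x|n B].
- by case: unpickle => [p|//]; exact: type_class_invariant.
- rewrite /= in_itv /= andbT => /lt0r_neq0 x0.
  have [N [l xl]] := type_class_cover cfin x0.
  by exists (pickle (N, l)) => //; rewrite pickleK.
case: unpickle => [p|B0]; first exact: type_class_notEmb.
(* An integer coding no type yields the empty class, which has no copy even of a singleton. *)
move=> /(_ [set 0] (finite_set1 _))[F' [[m [d [_ ->]]] /(_ (m * 0 + d))]].
by case/(_ (imageP _ erefl))/B0.
Qed.

(** * Continuum and well-orders *)

Section reals_onto_sequences.
Variable R : realType.

Definition digit (x : R) (n : nat) : bool := odd (Num.trunc (4 ^+ n.+1 * x)).

Fixpoint digits_value (s : nat -> bool) (n : nat) : nat :=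
  if n is m.+1 then 4 * digits_value s m + s m else 0.

(* The digits 0 and 1 in base 4 leave room for the tail: no carry occurs. *)
Lemma digit_surj (s : nat -> bool) : exists x, digit x = s.
Proof.
pose d n : R := (4 ^+ n)^-1.
have d0 n : 0 < d n by rewrite invr_gt0 exprn_gt0.
have dS n : d n = 4 * d n.+1.
  by rewrite /d exprS invfM mulrA divff// mul1r.
pose u n : R := (digits_value s n)%:R * d n.
have uS n : u n.+1 = u n + (s n)%:R * d n.+1.
  by rewrite /u /= natrD natrM [d n]dS; ring.
have u_nondecr : {homo u : m n / (m <= n)%N >-> m <= n}.
  apply: homo_leq => //; first exact: le_trans.
  by move=> n; rewrite uS lerDl mulr_ge0// ltW.
have v_nonincr m n : (m <= n)%N -> u n + d n / 3 <= u m + d m / 3.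
  elim: n m => [|n IH] m; first by rewrite leqn0 => /eqP ->.
  rewrite leq_eqVlt => /predU1P[->//|mn]; apply: le_trans (IH m mn).
  rewrite uS [d n]dS; have := d0 n.+1.
  by case: (s n) => /=; lra.
have uv m n : u m <= u n + d n / 3.
  have [mn|/ltnW nm] := leqP m n.
    have := u_nondecr _ _ mn; have := d0 n; lra.
  have := v_nonincr _ _ nm; have := d0 m; lra.
(* The supremum lies between [u m] and [u m + d m / 3] for every [m]; at [m = n.+1], multiplying by
   [4 ^+ n.+1] gives an integer of parity [s n] plus at most 1/3. *)
exists (sup (range u)); apply/funext => n; rewrite /digit.
have x1 m : u m <= sup (range u).
  apply: ub_le_sup; last by exists m.
  by exists (u 0 + d 0 / 3) => _ [k _ <-].
have x2 m : sup (range u) <= u m + d m / 3.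
  by apply: ge_sup; [exists (u 0), 0%N|move=> _ [k _ <-]].
have -> : Num.trunc (4 ^+ n.+1 * sup (range u)) = digits_value s n.+1.
  have e0 : 0 < 4 ^+ n.+1 :> R by rewrite exprn_gt0.
  have ed : 4 ^+ n.+1 * d n.+1 = 1 by rewrite /d divff// gt_eqF.
  have eu : 4 ^+ n.+1 * u n.+1 = (digits_value s n.+1)%:R.
    by rewrite /u mulrC -mulrA (mulrC (d _)) ed mulr1.
  apply: truncn_def; apply/andP; split.
    by have := x1 n.+1; rewrite -(ler_pM2l e0) eu.
  have := x2 n.+1; rewrite -(ler_pM2l e0) mulrDr eu mulrA ed -natr1; lra.
by rewrite /= oddD oddM /=; case: (s n).
Qed.

(** The truth values of [q < z i], for rational [q], determine [z] and form one binary sequence,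
    which is the digit sequence of some real. Thus reals can index all null sequences. *)
Lemma reals_onto_sequences : exists psi : R -> nat -> R,
  forall z, exists r, psi r = z.
Proof.
pose iota (z : nat -> R) n :=
  if unpickle n is Some p then ratr p.2 < z p.1 else false.
have iota_le z z' : iota z = iota z' -> forall i, z i <= z' i.
  move=> zz' i; rewrite leNgt; apply/negP => /rat_in_itvoo[q].
  rewrite in_itv /= => /andP[q1 q2].
  have := congr1 (@^~ (pickle (i, q))) zz'.
  by rewrite /iota /= pickleK /= q2 ltNge (ltW q1).
have iota_inj : injective iota.
  by move=> z z' zz'; apply/funext => i; apply/eqP; rewrite eq_le !iota_le.
have /choice[psi psiP] : forall r, exists z,
    forall z', iota z' = digit r -> z' = z.
  move=> r; have [[z zr]|nz] := pselect (exists z, iota z = digit r).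
    by exists z => z' z'r; apply: iota_inj; rewrite z'r.
  by exists (fun=> 0) => z' z'r; case: nz; exists z'.
exists psi => z; have [r rz] := digit_surj (iota z).
by exists r; apply/esym/psiP.
Qed.

Lemma nat_not_onto_reals (h : nat -> R) : exists r, forall n, h n <> r.
Proof.
have [r rE] := digit_surj (fun n => ~~ digit (h n) n).
by exists r => n hn; have := congr1 (@^~ n) rE; rewrite /= -hn; case: digit.
Qed.

End reals_onto_sequences.

(** * Well-orders and transfinite recursion *)

Section well_orders.

Record well_ordered (T : Type) (W : rel T) : Prop := WellOrdered {
  wo_total : total W;
  wo_trans : transitive W;
  wo_anti : antisymmetric W;
  wo_min : forall P : set T, P !=set0 ->
    exists2 m, P m & forall x, P x -> W m x }.

Lemma well_ordered_exists (T : eqType) : exists W : rel T, well_ordered W.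
Proof.
have [W woW] := well_ordering_principle T; exists W.
have minW (P : set T) : P !=set0 -> exists2 m, P m & forall x, P x -> W m x.
  move=> [x0 Px0]; have [|m [[mP lbm] _]] := woW [pred x | `[< P x >]].
    by exists x0; apply/asboolP.
  exists m; first by apply/asboolP.
  by move=> x Px; apply: lbm; apply/asboolP.
have chainW : wo_chain W predT by apply: withinW.
have totW : total W by move=> x y; exact: (wo_chainW chainW).
have antiW : antisymmetric W.
  by move=> x y; exact: (wo_chain_antisymmetric chainW).
split=> // y x z xy yz.
have [|m] := minW [set x; y; z]; first by exists x; left; left.
move=> + mW; case=> [[]|] /= mE; rewrite {}mE in mW.
- by apply: mW; right.
- have xE : x = y by apply: antiW; rewrite xy mW//; left; left.
  by rewrite xE.
- have yE : y = z by apply: antiW; rewrite yz mW//; left; right.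
  by rewrite -yE.
Qed.

Definition strict (T : eqType) (W : rel T) x y := W x y && (x != y).

Lemma strict_wf (T : eqType) (W : rel T) : well_ordered W ->
  well_founded (fun x y => strict W x y).
Proof.
move=> woW x; apply: contrapT => nx.
have [|m nm mW] := wo_min woW (P := [set x | ~ Acc (fun x y => strict W x y) x]).
  by exists x.
apply: nm; split=> y /andP[ym nym]; apply: contrapT => ny.
by move/eqP: nym; apply; apply: (wo_anti woW); rewrite ym mW.
Qed.

Lemma well_ordered_lexi (T U : eqType) (V : rel T) (W : rel U) (f : U -> T) :
  well_ordered V -> well_ordered W ->
  well_ordered (fun x y => strict V (f x) (f y) || ((f x == f y) && W x y)).
Proof.
move=> woV woW; split.
- move=> x y; rewrite /strict eq_sym (eq_sym (f y)).
  have [fE|_] := eqVneq; first by rewrite !andbF /= (wo_total woW).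
  by rewrite !andbT !orbF (wo_total woV).
- move=> y x z /orP[/andP[xy nxy]|/andP[/eqP fxy xy]].
    move=> /orP[/andP[yz nyz]|/andP[/eqP fyz yz]]; apply/orP; left.
      rewrite /strict (wo_trans woV xy yz) /=; apply: contra_neq nxy => fxz.
      by apply: (wo_anti woV); rewrite xy fxz yz.
    by rewrite /strict -fyz xy.
  rewrite fxy => /orP[->//|/andP[-> yz]]; apply/orP; right.
  exact: wo_trans xy yz.
- move=> x y; rewrite /strict eq_sym (eq_sym (f y)).
  have [fE|nf] := eqVneq; first by rewrite !andbF /=; exact: wo_anti.
  rewrite !andbT !orbF => /(wo_anti woV) fE.
  by rewrite fE eqxx in nf.
- move=> P [x0 Px0].
  have [|t [x1 Px1 fx1] tV] := wo_min woV (P := f @` P).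
    by exists (f x0), x0.
  have [|m [Pm fm] mW] := wo_min woW (P := [set x | P x /\ f x = t]).
    by exists x1.
  exists m => // x Px; rewrite /strict fm.
  have [tE|tN] := eqVneq; first by rewrite mW ?orbT.
  by rewrite andbT tV//; exists x.
Qed.

(** Transfinite recursion with a choice at each stage. [P j] receives a total function: the values
    chosen below [j], and the default [s0] elsewhere. *)
Lemma wf_choice (T : Type) (S : Type) (s0 : S) (lt : T -> T -> Prop)
    (P : T -> (T -> S) -> S -> Prop) : well_founded lt ->
  (forall j f, exists x, P j f x) ->
  exists tau, forall j,
    P j (fun i => if `[< lt i j >] then tau i else s0) (tau j).
Proof.
move=> wf PE.
have /choice[ch chP] : forall p, exists x, P p.1 p.2 x by move=> p; exact: PE.
pose step j (rec : forall i, lt i j -> S) := ch (j, fun i =>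
  if pselect (lt i j) is left p then rec i p else s0).
exists (Fix wf _ step) => j; rewrite [X in P j _ X]Fix_eq; last first.
  move=> i r1 r2 r12; congr (ch (_, _)); apply/funext => k.
  by case: pselect.
suff -> : (fun i => if `[< lt i j >] then Fix wf _ step i else s0) =
    (fun i => if pselect (lt i j) is left p then Fix wf _ step i else s0).
  exact: (chP (j, _)).
by apply/funext => i; case: pselect => p; [rewrite asboolT|rewrite asboolF].
Qed.

End well_orders.

(** * Sets of reals whose labelled words enumerate the line *)

Section large_sets.
Variable R : realType.
Local Notation word := (seq (R * nat)).
Implicit Types (X Y : set R) (s : word).

Definition spelled X s := forall p, p \in s -> X p.1.

(* Words carry natural number labels so that the words over a large set encode
   finite sequences of words, without any cardinal arithmetic. *)
Definition large X := exists h : word -> R,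
  forall r, exists2 s, spelled X s & h s = r.

Lemma spelled_subset X Y s : X `<=` Y -> spelled X s -> spelled Y s.
Proof. by move=> XY sX p /sX/XY. Qed.

(** Words over one letter are determined by their labels, hence countable. *)
Lemma not_large_set1 r0 : ~ large [set r0].
Proof.
move=> [h hP].
have [r rh] := nat_not_onto_reals
  (fun n => h [seq (r0, k) | k <- odflt [::] (unpickle n)]).
have [s sr0 hs] := hP r; apply: (rh (pickle [seq p.2 | p <- s])).
rewrite pickleK /= -map_comp -[in RHS]hs; congr h; rewrite -[RHS]map_id.
by apply/eq_in_map => -[x k] /sr0 /= ->.
Qed.

(** The lost letter [a] is respelled as [r0] with an odd label; all other letters get even
    labels. *)
Lemma large_remove1 X a r0 : X r0 -> r0 != a -> large X -> large (X `\ a).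
Proof.
move=> Xr0 r0a [h hP].
pose enc (p : R * nat) := if p.1 == a then (r0, p.2.*2.+1) else (p.1, p.2.*2).
pose dec (p : R * nat) := if odd p.2 then (a, p.2./2) else (p.1, p.2./2).
have encK : cancel enc dec.
  move=> [x n]; rewrite /enc /dec /=; case: eqP => [->|_] /=.
    by rewrite odd_double /= uphalf_double.
  by rewrite odd_double doubleK.
exists (fun s => h [seq dec p | p <- s]) => r; have [s Xs hs] := hP r.
exists [seq enc p | p <- s]; last by rewrite mapK.
move=> p /mapP[[x n] /Xs Xx ->]; rewrite /enc /=.
by case: eqP => [_|/= xa]; split=> //; apply/eqP.
Qed.

(** An even label marks a letter of the current word; an odd one ends the word and carries its
    number. Unfinished trailing letters are dropped. *)
Fixpoint words_of (s : word) : seq (word * nat) :=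
  if s is (x, n) :: s' then
    if odd n then ([::], n./2) :: words_of s'
    else if words_of s' is (w, k) :: ws then ((x, n./2) :: w, k) :: ws else [::]
  else [::].

Lemma words_of_surj X x0 (ws : seq (word * nat)) : X x0 ->
  (forall w, w \in ws -> spelled X w.1) ->
  exists2 s, spelled X s & words_of s = ws.
Proof.
move=> Xx0; elim: ws => [|[w k] ws IH] Xws; first by exists [::].
have [|s Xs sws] := IH; first by move=> v vs; apply: Xws; rewrite inE vs orbT.
have Xw : spelled X w by apply: (Xws (w, k)); rewrite mem_head.
exists ([seq (p.1, p.2.*2) | p <- w] ++ (x0, k.*2.+1) :: s).
  move=> p; rewrite mem_cat inE => /or3P[/mapP[q /Xw Xq ->]|/eqP ->|/Xs] //.
elim: w {Xws Xw} => [|[x n] w IHw] /=.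
  by rewrite odd_double /= uphalf_double sws.
by rewrite odd_double IHw doubleK.
Qed.

End large_sets.

Section rational_span.
Variables (R : realType) (J : eqType).
Implicit Types (D : J -> Prop) (G : J -> nat -> R).

Definition rat_span D G : set R := [set x | exists2 t : seq (rat * (J * nat)),
  forall p, p \in t -> D p.2.1 & x = \sum_(p <- t) ratr p.1 * G p.2.1 p.2.2].

Lemma rat_spanD D G x y : rat_span D G x -> rat_span D G y ->
  rat_span D G (x + y).
Proof.
move=> [t tD ->] [u uD ->]; exists (t ++ u); last by rewrite big_cat.
by move=> p; rewrite mem_cat => /orP[/tD|/uD].
Qed.

Lemma rat_spanZ D G q x : rat_span D G x -> rat_span D G (ratr q * x).
Proof.
move=> [t tD ->]; exists [seq (q * p.1, p.2) | p <- t].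
  by move=> p /mapP[p' /tD ? ->].
by rewrite big_map mulr_sumr; apply: eq_bigr => p _; rewrite rmorphM mulrA.
Qed.

Lemma rat_span0 D G : rat_span D G 0.
Proof. by exists [::] => //; rewrite big_nil. Qed.

Lemma rat_span_gen D G j n : D j -> rat_span D G (G j n).
Proof.
move=> Dj; exists [:: (1, (j, n))]; first by move=> p; rewrite inE => /eqP ->.
by rewrite big_seq1 rmorph1 mul1r.
Qed.

End rational_span.

Section small_initial_segments.
Variable R : realType.
Local Notation word := (seq (R * nat)).

(* Take the least initial segment [I] of the reals that is large, and order the
   words over [I] first by their greatest letter: the words below [j] are spelled
   by a set that is not large, so they cannot generate the reals even with
   countably many arbitrary reals attached to each. *)
Lemma small_initial_segments :
  exists (W : rel word) (D : set word) (e : word -> R),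
  [/\ well_ordered W,
      forall r, exists2 j, D j & e j = r &
      forall j (G : word -> nat -> R), D j ->
        exists x, ~ rat_span (fun i => W i j) G x].
Proof.
have [V woV] := well_ordered_exists R.
have [V' woV'] := well_ordered_exists word.
have VV x : V x x by have := wo_total woV x x; rewrite orbb.
have [|r0 _ r0min] := wo_min woV (P := setT); first by exists 0.
have [I [Ir0 [h hP] Ismall]] : exists I : set R,
    [/\ I r0, large I & forall a, I a -> ~ large [set x | V x a]].
  have [[a0 La0]|nL] := pselect (exists a, large [set x | V x a]); last first.
    exists setT; split=> // [|a _ La]; last by apply: nL; exists a.
    exists (fun s => (head (0, 0) s).1) => r.
    by exists [:: (r, 0)].
  have [|a La amin] := wo_min woV (P := [set a | large [set x | V x a]]).
    by exists a0.
  have ar0 : r0 != a.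
    apply/eqP => r0a; apply: (@not_large_set1 _ r0).
    rewrite (_ : [set r0] = [set x | V x a])//.
    apply/seteqP; split=> x /= => [->|xa]; first by rewrite r0a.
    by apply: (wo_anti woV); rewrite r0min// andbT r0a.
  (* Dropping the greatest element [a] keeps the segment large, and by minimality of [a] no segment
     ending inside it is large. *)
  exists ([set x | V x a] `\ a); split.
  - by split; [exact: r0min|exact/eqP].
  - by apply: (large_remove1 _ ar0 La); exact: r0min.
  - move=> b [/= ba nba] Lb; apply: nba; apply: (wo_anti woV).
    by rewrite ba amin.
(* [mx s] is the greatest letter of [s]; the empty word gets [r0], the least real for [V]. *)
have /choice[mx mxP] : forall s : word, exists a,
    (a = r0 \/ exists2 p, p \in s & p.1 = a) /\ spelled [set x | V x a] s.
  elim=> [|p s [a [aE sa]]]; first by exists r0; split; [left|].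
  have [pa|ap] := orP (wo_total woV p.1 a).
    exists a; split.
      case: aE => [->|[q qs qa]]; [by left|right].
      by exists q => //; rewrite inE qs orbT.
    by move=> q; rewrite inE => /predU1P[->|/sa].
  exists p.1; split; first by right; exists p; rewrite ?mem_head.
  move=> q; rewrite inE => /predU1P[->|/sa /= qa]; first exact: VV.
  exact: wo_trans woV _ _ _ qa ap.
have woW := well_ordered_lexi mx woV woV'.
set W := (fun x y : word => _) in woW.
exists W, (spelled I), h; split=> // j G Ij.
have Imx : I (mx j).
  by have [[->|[p /Ij Ip <-]] _] := mxP j.
apply: contrapT => span_all; apply: (Ismall _ Imx).
have [code [decode codeK]] : exists (code : rat * nat -> nat) decode,
    pcancel code decode.
  by exists pickle, unpickle; exact: pickleK.
(* A word with a number coding [(q, n)] stands for one term of a combination. If these combinations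
   gave every real, the letters up to [mx j] would form a large set. *)
pose value (w : word * nat) : R :=
  if decode w.2 is Some p then ratr p.1 * G w.1 p.2 else 0.
exists (fun s => \sum_(w <- words_of s) value w) => r.
have [t tj ->] : rat_span (fun i => W i j) G r.
  by apply: contrapT => nr; apply: span_all; exists r.
have [|w|s sj sE] := @words_of_surj R [set x | V x (mx j)] (mx j)
  [seq (p.2.1, code (p.1, p.2.2)) | p <- t].
- exact: VV.
- move=> /mapP[p /tj pj ->] /=; have [_] := mxP p.2.1.
  apply: spelled_subset => x /= xp; apply: wo_trans woV _ _ _ xp _.
  by case/orP: pj => /andP[// /eqP ->].
- exists s => //; rewrite sE big_map; apply: eq_bigr => p _.
  by rewrite /value /= codeK.
Qed.

End small_initial_segments.

(** * A progression-free shift-compact set *)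

Section shift_compact_without_progressions.
Variable R : realType.

Definition progression_free (W : set R) :=
  forall x y z, W x -> W y -> W z -> x + z = 2 * y -> x = y.

(** In a proper progression each of [|x|], [2 * |y|], [|z|] is at most the sum of the other two,
    which fails when one absolute value exceeds 4 times each of the others. *)
Lemma lacunary_progression_free (W : set R) :
  (forall x y, W x -> W y -> x != y -> 4 * `|x| < `|y| \/ 4 * `|y| < `|x|) ->
  progression_free W.
Proof.
move=> lacW x y z Wx Wy Wz xzy; apply: contrapT => /eqP xy.
have yz : y != z by apply: contra_neq xy => yz; lra.
have xz : x != z by apply: contra_neq xy => xz; lra.
have y2 : 2 * `|y| <= `|x| + `|z|.
  by rewrite -(@ger0_norm _ 2)// -normrM -xzy ler_normD.
have x2 : `|x| <= 2 * `|y| + `|z|.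
  have -> : x = 2 * y - z by lra.
  by rewrite (le_trans (ler_normB _ _))// normrM ger0_norm.
have z2 : `|z| <= 2 * `|y| + `|x|.
  have -> : z = 2 * y - x by lra.
  by rewrite (le_trans (ler_normB _ _))// normrM ger0_norm.
have := normr_ge0 x; have := normr_ge0 y; have := normr_ge0 z.
by case: (lacW _ _ Wx Wy xy); case: (lacW _ _ Wy Wz yz);
   case: (lacW _ _ Wx Wz xz); lra.
Qed.

(** [{0}] serves when [z] does not tend to 0 or vanishes infinitely often. Otherwise, from some rank
    on, every term is nonzero and has a successor more than 4 times smaller. *)
Lemma progression_free_subsequence (z : nat -> R) : exists W : set R,
  [/\ W 0, W `<=` [set 0] `|` range z, progression_free W &
      z @ \oo --> (0 : R) -> infinite_set [set m | W (z m)]].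
Proof.
have trivW : progression_free [set 0 : R] by move=> x y w -> ->.
have [z0|nz0] := pselect (z @ \oo --> (0 : R)); last first.
  by exists [set 0]; split=> // x ->; left.
have [inf0|fin0] := pselect (infinite_set [set m | z m = 0]).
  by exists [set 0]; split=> // x ->; left.
have [N Nz] : exists N, forall m, (N <= m)%N -> z m != 0.
  have /contrapT/finite_seqP[s sE] := fin0.
  exists (\max_(m <- s) m).+1 => m; apply: contraTneq => zm0.
  rewrite -ltnNge ltnS; have ms : m \in s.
    by have : [set m | z m = 0] m by []; rewrite sE.
  exact: leq_bigmax_seq.
have /choice[next nextP] : forall m, exists m', z m != 0 ->
    z m' != 0 /\ 4 * `|z m'| < `|z m|.
  move=> m; have [->|zm] := eqVneq (z m) 0; first by exists 0.
  have e0 : 0 < `|z m| / 4 by rewrite divr_gt0 ?normr_gt0.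
  have /cvgr0Pnorm_lt/(_ _ e0)[M _ Mz] := z0.
  exists (maxn N M) => _; split; first by rewrite Nz ?leq_maxl.
  by have := Mz _ (leq_maxr N M) => /=; lra.
pose phi k := iter k next N.
have phi0 k : z (phi k) != 0.
  by elim: k => [|k IH]; [exact: Nz|have [] := nextP _ IH].
have phi_lac k l : (k < l)%N -> 4 * `|z (phi l)| < `|z (phi k)|.
  elim: l => // l IH; rewrite ltnS leq_eqVlt => /predU1P[->|/IH kl].
    by have [] := nextP _ (phi0 l).
  have [_] := nextP _ (phi0 l); rewrite -/(phi l.+1).
  by have := normr_ge0 (z (phi l)); lra.
exists ([set 0] `|` range (z \o phi)); split.
- by left.
- by move=> x [->|[k _ <-]]; [left|right; exists (phi k)].
- apply: lacunary_progression_free => x y [->|[k _ <-]] [->|[l _ <-]] /=.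
  + by rewrite eqxx.
  + by left; rewrite normr0 mulr0 normr_gt0.
  + by right; rewrite normr0 mulr0 normr_gt0.
  + have [kl|lk|->] := ltngtP k l; last by rewrite eqxx.
    * by right; exact: phi_lac.
    * by left; exact: phi_lac.
- move=> _ finW.
  have phi_inj : injective phi.
    move=> k l kl; have z_ge0 := normr_ge0 (z (phi l)).
    by have [/phi_lac|/phi_lac|//] := ltngtP k l;
       rewrite kl => ?; exfalso; clear kl; lra.
  apply/infinite_nat/(sub_finite_set _ (finite_preimage (in2W phi_inj) finW)).
  by move=> k _; right; exists k.
Qed.

Lemma progression_free_notEmb (A : set R) : progression_free A -> ~ Emb R A.
Proof.
move=> freeA /(_ [set x | x \in [:: 0; 1; 2]])[|F' [[m [d [m0 ->]]] F'A]].
  exact: finite_seq.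
have mem x : x \in [:: 0; 1; 2] -> A (m * x + d).
  by move=> xs; apply: F'A; exists x.
have := freeA _ _ _ (mem 0 _) (mem 1 _) (mem 2 _).
rewrite !inE !eqxx !orbT => /(_ isT isT isT) E.
by move/eqP: m0; apply; have := E ltac:(ring); lra.
Qed.

Lemma shift_compact_progression_free :
  exists A : set R, SC R A /\ progression_free A.
Proof.
have [psi psiP] := reals_onto_sequences R.
have [W [D [e [woW eP span_small]]]] := small_initial_segments R.
have /choice[C CP] := progression_free_subsequence.
pose z j := psi (e j).
(* Row [i] holds the translation at index 0 and the terms of the [i]-th sequence at shifted
   indices. *)
pose gen (f : seq (R * nat) -> R) i n := if n is m.+1 then z i m else f i.
(* The span includes row [j] itself: the terms of [z j] must be avoided too, while its entry of
   index 0 is still the default 0. *)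
have [tau tauP] := @wf_choice _ R 0 _ (fun j f x => D j ->
    ~ rat_span (fun i => W i j) (gen f) x) (strict_wf woW)
  (fun j f => ltac:(have [Dj|nDj] := pselect (D j);
    [by have [x] := span_small j (gen f) Dj; exists x|by exists 0])).
pose f j i := if `[< strict W i j >] then tau i else 0.
have {}tauP j : D j -> ~ rat_span (fun i => W i j) (gen (f j)) (tau j) := tauP j.
pose A := [set x | exists j, D j /\ exists2 w, C (z j) w & x = tau j + w].
exists A; split.
  move=> z' z'0; have [r rz'] := psiP z'; have [j Dj ej] := eP r.
  have zj : z j = z' by rewrite /z ej.
  have [C0 _ _ infC] := CP z'.
  exists (tau j); split.
    by exists j; split=> //; exists 0; rewrite ?zj ?addr0.
  apply: sub_infinite_set (infC z'0) => m Cm.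
  by exists j; split=> //; exists (z' m); rewrite ?zj.
move=> _ _ _ [j1 [D1 [w1 C1 ->]]] [j2 [D2 [w2 C2 ->]]] [j3 [D3 [w3 C3 ->]]] E.
have maxW a b : exists m, [/\ m = a \/ m = b, W a m & W b m].
  have WW x : W x x by have := wo_total woW x x; rewrite orbb.
  have [ab|ba] := orP (wo_total woW a b).
    by exists b; split=> //; right.
  by exists a; split=> //; left.
have [j' [j'E j1j' j2j']] := maxW j1 j2; have [j [jE j'j j3j]] := maxW j' j3.
have j1j : W j1 j := wo_trans woW j1j' j'j.
have j2j : W j2 j := wo_trans woW j2j' j'j.
have {j' j'E j1j' j2j' j'j} jE : [\/ j1 = j, j2 = j | j3 = j].
  case: jE => ->; last exact: Or33.
  by case: j'E => ->; [exact: Or31|exact: Or32].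
have Dj : D j by case: jE => <-.
set S := rat_span (fun i => W i j) (gen (f j)).
have nS : ~ S (tau j) by exact: tauP.
have Sw i w : W i j -> C (z i) w -> S w.
  have [_ Cz _ _] := CP (z i).
  move=> ij /Cz[->|[m _ <-]]; first exact: rat_span0.
  exact: (@rat_span_gen _ _ (fun i => W i j) (gen (f j)) i m.+1).
have Stau i : W i j -> S (tau i - (i == j)%:R * tau j).
  move=> ij; have [->|nij] := eqVneq i j.
    by rewrite mul1r subrr; exact: rat_span0.
  have := @rat_span_gen _ _ (fun i => W i j) (gen (f j)) i 0 ij.
  by rewrite /= /f mul0r subr0 asboolT// /strict ij.
(* The coefficient of [tau j] in the relation, [j] being the last of the three indices; everything
   else lies in [S]. It vanishes only if all three indices equal [j], which leaves a progression in
   [C (z j)]. *)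
pose k : rat := (j1 == j)%:R + (j3 == j)%:R - 2 * (j2 == j)%:R.
have Sk : S (ratr k * tau j).
  have -> : ratr k * tau j =
      ratr 2 * (w2 + (tau j2 - (j2 == j)%:R * tau j)) +
      ratr (-1) * (w1 + (tau j1 - (j1 == j)%:R * tau j) +
                   (w3 + (tau j3 - (j3 == j)%:R * tau j))).
    by rewrite /k rmorphB rmorphD rmorphM rmorphN1 !rmorph_nat; lra.
  have Sws i w : W i j -> C (z i) w -> S (w + (tau i - (i == j)%:R * tau j)).
    by move=> ij Cw; apply: rat_spanD; [exact: Sw Cw|exact: Stau].
  apply: rat_spanD; apply: rat_spanZ; first exact: Sws.
  by apply: rat_spanD; exact: Sws.
have k0 : k = 0.
  apply/eqP; apply: contrapT => /negP k0; apply: nS.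
  have k0' : ratr k != 0 :> R by rewrite fmorph_eq0.
  by rewrite -[tau j](mulKf k0') -fmorphV; exact: rat_spanZ.
have [/eqP j1E /eqP j2E /eqP j3E] : [/\ j1 == j, j2 == j & j3 == j].
  have : (j1 == j) || (j2 == j) || (j3 == j).
    by case: jE => ->; rewrite eqxx ?orbT.
  by move: k0; rewrite /k; do 3 (case: (_ == j)).
rewrite {}j1E {}j2E {}j3E in C1 C2 C3 E *.
have [_ _ freeC _] := CP (z j); rewrite (freeC _ _ _ C1 C2 C3)//; lra.
Qed.

Lemma SC_not_sub_Emb : ~ (SC R `<=` Emb R).
Proof.
have [A [scA freeA]] := shift_compact_progression_free.
by move=> /(_ A scA); exact: progression_free_notEmb.
Qed.

End shift_compact_without_progressions.

(** * A non-measurable set *)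

Section nonmeasurable.
Variable R : realType.
Local Notation mu := (@lebesgue_outer_measure R).

(** As [w < 0], each [x - n * w] is to the right of [x]; so translates of the positive part of [S]
    by multiples of [w] cover []0, 1]]. *)
Lemma not_null_if_translates_cover (S : set R) w : w < 0 ->
  (forall x, exists n : nat, S (x - n%:R * w)) ->
  mu (S `&` `]0, +oo[) <> 0%E.
Proof.
move=> w0 Scov S0.
pose T n := (fun x => 1 * x + n%:R * w) @` (S `&` `]0, +oo[).
have T0 n : mu (T n) = 0%E.
  apply/eqP; rewrite eq_le outer_ge0 andbT.
  by apply: le_trans (outer_affine _ _ ltr01) _; rewrite S0 mule0.
have : (mu `]0%R, 1%R]%classic <= mu (\bigcup_n T n))%E.
  apply: outer_le => x; rewrite /= in_itv /= => /andP[x0 _].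
  have [n Sx] := Scov x; exists n => //; exists (x - n%:R * w); last by ring.
  split=> //; rewrite /= in_itv /= andbT.
  by have : n%:R * w <= 0 by [rewrite mulr_ge0_le0// ltW|]; lra.
by rewrite (outer_bigcup0 T0) outer_itv// subr0 lee_fin ler10.
Qed.

Lemma nonpos_invariant (f : {additive R -> R}) : rat_invariant (nonpos_set f).
Proof.
move=> q x q0 fx; rewrite /nonpos_set /= additive_ratrM.
by rewrite pmulr_rle0// ltr0q.
Qed.

(** The set [f <= 0] and its complement both have outer measure 1 in []0, 1]], against additivity.
    Adjoining [[-1, 0]] gives membership in [BC] and leaves []0, 1]] untouched. *)
Lemma nonmeasurable_BC : exists A : set R, ~ lebesgue_measurable A /\ BC R A.
Proof.
have [f [f1 [v v0 fv] _]] := rational_functional R.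
(* Subtracting [w] moves to the right while lowering [f]; such a [w] is 1 plus a suitable multiple
   of the kernel element [v]. *)
have [w w0 fw] : exists2 w, w < 0 & f w = 1.
  have [n vn] := exists_nat_gt (`|v|^-1).
  have : 1 < n%:R * `|v| by rewrite -ltr_pdivrMr ?normr_gt0// mul1r.
  have fqv q : f (1 + ratr q * v) = 1.
    by rewrite raddfD /= additive_ratrM fv mulr0 addr0 f1.
  have [v_ge0|v_lt0] := ger0P v => nv.
    by exists (1 + ratr (- n%:R) * v); [rewrite rmorphN /= ratr_nat; lra|].
  by exists (1 + ratr n%:R * v); [rewrite ratr_nat; lra|].
have inv' : rat_invariant (~` nonpos_set f).
  move=> q x q0 /negP; rewrite -ltNge => fx; apply/negP.
  by rewrite -ltNge additive_ratrM mulr_gt0// ltr0q.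
have full : mu (nonpos_set f `&` `]0, 1]) = 1%E.
  have [|//] := zero_one_law (@nonpos_invariant f).
  move/(not_null_if_translates_cover w0) => []// x.
  have [n fxn] := exists_nat_gt (f x); exists n.
  by rewrite /nonpos_set /= raddfB /= mulr_natl raddfMn fw; lra.
have full' : mu (~` nonpos_set f `&` `]0, 1]) = 1%E.
  have [|//] := zero_one_law inv'.
  move/(not_null_if_translates_cover (ltrN10 R)) => []// x.
  have [n fxn] := exists_nat_gt (- f x); exists n; apply/negP; rewrite -ltNge.
  by rewrite mulrN1 opprK raddfD /= additive_nat f1; lra.
exists (nonpos_set f `|` `[-1, 0]); split; last first.
  apply: BC_superset (BC_interval (ltrN10 R)).
  exact: subsetUr.
move=> /(_ `]0, 1]%classic).
have -> : `]0, 1] `&` (nonpos_set f `|` `[-1, 0]) = nonpos_set f `&` `]0, 1].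
  apply/seteqP; split=> x /=; rewrite !in_itv /=; last first.
    by case=> ? ->; split; [|left].
  by move=> [x01 [//|/andP[_ x0]]]; move: x01; rewrite ltNge x0.
have -> : `]0, 1] `&` ~` (nonpos_set f `|` `[-1, 0]) =
    ~` nonpos_set f `&` `]0, 1].
  apply/seteqP; split=> x /=; rewrite !in_itv /=.
    by move=> [? nf]; split=> // fx; apply: nf; left.
  by move=> [nf x01]; split=> // -[//|/andP[_ x0]]; move: x01; rewrite ltNge x0.
rewrite -!/(mu _) full full' outer_itv// subr0 -EFinD => -[].
by move/eqP; rewrite eq_sym -subr_eq0 addrK oner_eq0.
Qed.

End nonmeasurable.

(** * Assembly of the nine assertions *)

Theorem theorem3 (R : realType) :
  (* (i) *)
  (~ (SW R `<=` BC R) /\ ~ (BC R `<=` SW R)) /\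
  (* (ii) *)
  (~ (Emb R `<=` SC R) /\ ~ (SC R `<=` Emb R)) /\
  (* (iii) *)
  (exists A : set R, A `<=` `[0, 1] /\
     lebesgue_outer_measure A = 1%E /\ ~ Emb R A) /\
  (* (iv) *)
  (exists A : set R, A `<=` `[0, 1] /\
     (forall a b : R, a < b -> `[a, b] `<=` `[(0 : R), 1] ->
        second_category (A `&` `[a, b])) /\
     ~ Emb R A) /\
  (* (v) *)
  (exists A : set R, A `<=` `[0, 1] /\
     lebesgue_outer_measure A = 1%E /\ ~ BC R A) /\
  (* (vi) *)
  (exists A : set R, A `<=` `[0, 1] /\
     (forall a b : R, a < b -> `[a, b] `<=` `[(0 : R), 1] ->
        second_category (A `&` `[a, b])) /\
     ~ BC R A) /\
  (* (vii) *)
  (exists A : set R, ~ lebesgue_measurable A /\ BC R A) /\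
  (* (viii) *)
  (exists A : set R, ((SW R `&` Emb R) `\` SC R) A) /\
  (* (ix) *)
  (SC R `<` SW R /\ SC R `<` BC R).
Proof.
have [f [f1 [v v0 fv] nlin]] := rational_functional R.
have HnotBC : ~ BC R (nonpos_set f) by exact: nonpos_notBC nlin _.
have HnotSC : ~ SC R (nonpos_set f) by move/SC_sub_BC.
have HSW := nonpos_SW f1; have HEmb := nonpos_Emb f1.
have PBC := even_part_BC f1; have PnotSW := even_part_notSW f1 v0 fv.
have PnotSC : ~ SC R (even_part f) by move/SC_sub_SW.
have sub01 (B : set R) : B `&` `]0, 1] `<=` `[0, 1].
  by move=> x []; rewrite /= !in_itv /= => _ /andP[/ltW -> ->].
have [A [invA covA AnotEmb]] := similar_free_cover R.
(* The family is [f <= 0] followed by repetitions of [f >= 0]; the latter is the set of the first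
   kind for [- f]. *)
have [B [invB covB BnotBC]] : exists B : nat -> set R,
    [/\ forall n, rat_invariant (B n), `]0, +oo[%classic `<=` \bigcup_n B n &
        forall n C, C `<=` B n -> ~ BC R C].
  pose g : {additive R -> R} := -%R \o f.
  exists (fun n => if n is 0%N then nonpos_set f else nonpos_set g).
  split=> [[|n]|x _|[|n] C].
  - exact: nonpos_invariant.
  - exact: nonpos_invariant.
  - have [fx|/ltW fx] := leP (f x) 0; first by exists 0%N.
    by exists 1%N => //; rewrite /nonpos_set /= oppr_le0.
  - exact: nonpos_notBC.
  - apply: nonpos_notBC => /linear_realP glin; apply: nlin; apply/linear_realP.
    by move=> x; have := glin x; rewrite /g /= mulrN => /oppr_inj.
have [nA1 fullA] := full_outer_measure invA covA.
have [nA2 catA] := everywhere_second_category invA covA.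
have [nB1 fullB] := full_outer_measure invB covB.
have [nB2 catB] := everywhere_second_category invB covB.
split; [split|split; [split|split; [|split; [|split; [|split; [|split;
  [|split]]]]]]].
- by move=> /(_ _ HSW).
- by move=> /(_ _ PBC).
- by move=> /(_ _ HEmb).
- exact: SC_not_sub_Emb.
- exists (A nA1 `&` `]0, 1]); split; first exact: sub01.
  by split; [exact: fullA|apply: (AnotEmb nA1); exact: subIsetl].
- exists (A nA2 `&` `]0, 1]); split; first exact: sub01.
  by split; [exact: catA|apply: (AnotEmb nA2); exact: subIsetl].
- exists (B nB1 `&` `]0, 1]); split; first exact: sub01.
  by split; [exact: fullB|apply: (BnotBC nB1); exact: subIsetl].
- exists (B nB2 `&` `]0, 1]); split; first exact: sub01.
  by split; [exact: catB|apply: (BnotBC nB2); exact: subIsetl].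
- exact: nonmeasurable_BC.
- by exists (nonpos_set f).
- split; split; [exact: SC_sub_SW| |exact: SC_sub_BC|].
  + by move=> /(_ _ HSW).
  + by move=> /(_ _ PBC).
Qed.
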